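(* No history-based swap dynamic can be both Pareto-optimal and strategy-proof.
   Context: Housing market: an instance is $I=\langle \mathcal{N},\mathcal{R},L,\pi^0\rangle$ with $\mathcal{N}$ a set of $n$ agents, $\mathcal{R}$ a set of $n$ resources, $L$ a profile of strict linear orders $\succ_i$ over $\mathcal{R}$, one for each agent $a_i$, and $\pi^0$ an initial allocation; an allocation $\pi$ is a bijective assignment of one resource $\pi_{a_i}$ to each agent $a_i$. Standing assumption: instances are single-peaked, i.e. there is a linear order $\lhd$ over $\mathcal{R}$ such that for every agent $a_i$ with top resource $t_i$ and all resources $r,r'$, if $r'\lhd r\lhd t_i$ or $t_i\lhd r\lhd r'$ then $r\succ_i r'$. A swap-deal $\langle a_x,a_y\rangle$ between two distinct agents exchanges their current resources; it is improving for an agent if she strictly prefers the resource she would receive to the one she holds. History-based swap dynamic: a history $h$ is a finite sequence of proposed swap-deals, each with its status (successful or not). A history-based selection heuristic $\sigma$ is a function which, for every finite set of agents $\mathcal{N}$ and every history $h$ over $\mathcal{N}$, returns a swap-deal $\sigma(\mathcal{N},h)$ between two agents of $\mathcal{N}$. The associated swap dynamic starts on $I$ from $\pi^0$ and the empty history; at each round the deal $\sigma(\mathcal{N},h)$ is proposed; if both agents accept, it is implemented (the deal is successful), otherwise the allocation is unchanged; the deal with its status is appended to $h$. The process stops when, for every pair of agents $a_x,a_y$, the deal $\langle a_x,a_y\rangle$ has been unsuccessfully proposed at some round after which no successful deal involved $a_x$ or $a_y$. The outcome is the final allocation (if the process never stops, the allocation which is constant from some round on). A truthful agent accepts a proposed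 deal if and only if it is improving for her. The execution on $I$ is the one in which all agents are truthful. The swap dynamic is defined for instances of all sizes $n$. A swap dynamic is Pareto-optimal if on every instance its (truthful) outcome is a Pareto-optimal allocation, i.e. one for which there is no allocation $\pi'$ such that every agent $a_i$ receives in $\pi'$ the same resource or one she strictly prefers, with at least one agent strictly preferring hers. A swap dynamic is strategy-proof if, for every instance, at no point during the procedure can an agent be better off by accepting a deal that is not improving for her or by refusing one that is: for every instance, every agent $a_i$ and every round of the procedure, if $a_i$ deviates from the truthful answer at this round (all other agents being truthful throughout, and $a_i$ being truthful at the other rounds), she does not hold in the outcome a resource she strictly prefers (according to $\succ_i$) to the resource she would hold in the outcome of the truthful execution. *)

(* Defs.v *)
From mathcomp Require Import all_boot fingroup perm.
From Stdlib Require Classical_Prop.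

Set Implicit Arguments.
Unset Strict Implicit.
Unset Printing Implicit Defensive.

Definition strict_linear_order (T : eqType) (e : rel T) : Prop :=
  [/\ irreflexive e, transitive e & forall x y, x != y -> e x y || e y x].

(* [pref I i r r'] reads: agent [i] strictly prefers [r] to [r'].  The
   equality of the numbers of agents and resources follows from [initP]. *)
Record market (N R : finType) := Market {
  pref : N -> rel R;
  init : {ffun N -> R};
  prefP : forall i, strict_linear_order (pref i);
  initP : bijective init }.

Definition is_top (N R : finType) (I : market N R) (i : N) (t : R) : Prop :=
  forall r, r != t -> pref I i t r.

Definition single_peaked (N R : finType) (I : market N R) : Prop :=
  exists lhd : rel R,
    strict_linear_order lhd /\
    forall i t r r', is_top I i t ->
      (lhd r' r && lhd r t) || (lhd t r && lhd r r') -> pref I i r r'.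

Definition pareto_optimal (N R : finType) (I : market N R)
    (pi : {ffun N -> R}) : Prop :=
  ~ exists pi' : {ffun N -> R},
      [/\ bijective pi',
          forall i, pi' i = pi i \/ pref I i (pi' i) (pi i)
        & exists i, pref I i (pi' i) (pi i)].

(* Deals are ordered pairs only for convenience: (x, y) and (y, x) have the
   same effect, and either one counts as a proposal of the deal <x, y> (see
   [on_pair]). *)
Definition deal (N : finType) : Type := {p : N * N | p.1 != p.2}.

Definition involves (N : finType) (d : deal N) (x : N) : bool :=
  (x == (val d).1) || (x == (val d).2).

Definition on_pair (N : finType) (d : deal N) (x y : N) : bool :=
  (val d == (x, y)) || (val d == (y, x)).

(* Oldest proposal first; the boolean is [true] for a successful deal. *)
Definition history (N : finType) : Type := seq (deal N * bool).

(* There is no deal between fewer than two agents, so an unguarded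
   [forall N, history N -> deal N] would be an empty type. *)
Definition heuristic : Type :=
  forall N : finType, 1 < #|N| -> history N -> deal N.

Fixpoint settled (N : finType) (x y : N) (h : history N) : bool :=
  if h is (d, ok) :: h' then
    [&& on_pair d x y, ~~ ok
      & all (fun e => e.2 ==> ~~ (involves e.1 x || involves e.1 y)) h']
    || settled x y h'
  else false.

Definition stopped (N : finType) (h : history N) : bool :=
  [forall x : N, forall y : N, (x != y) ==> settled x y h].

Definition swap (N R : finType) (pi : {ffun N -> R}) (d : deal N) :
    {ffun N -> R} :=
  [ffun i => if i == (val d).1 then pi (val d).2
             else if i == (val d).2 then pi (val d).1 else pi i].

Definition improving (N R : finType) (I : market N R) (pi : {ffun N -> R})
    (d : deal N) (i : N) : bool :=
  pref I i (swap pi d i) (pi i).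

(* [dev t i] says that agent [i] gives at round [t] the opposite of her
   truthful answer. *)
Definition accepts (N R : finType) (I : market N R) (dev : nat -> N -> bool)
    (t : nat) (pi : {ffun N -> R}) (d : deal N) (i : N) : bool :=
  dev t i (+) improving I pi d i.

Definition round (N R : finType) (I : market N R) (sel : history N -> deal N)
    (dev : nat -> N -> bool) (t : nat) (s : {ffun N -> R} * history N) :
    {ffun N -> R} * history N :=
  let: (pi, h) := s in
  if stopped h then s else
  let d := sel h in
  let ok := accepts I dev t pi d (val d).1 && accepts I dev t pi d (val d).2 in
  (if ok then swap pi d else pi, rcons h (d, ok)).

Fixpoint run (N R : finType) (I : market N R) (sel : history N -> deal N)
    (dev : nat -> N -> bool) (t : nat) : {ffun N -> R} * history N :=
  if t is t'.+1 then round I sel dev t' (run I sel dev t')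
  else (init I, [::]).

(* Once the process has stopped, [run] no longer changes, so this covers both
   the final allocation of a process that stops and the eventually constant
   allocation of one that does not. *)
Definition is_outcome (N R : finType) (I : market N R)
    (sel : history N -> deal N) (dev : nat -> N -> bool)
    (pi : {ffun N -> R}) : Prop :=
  exists T, forall t, T <= t -> (run I sel dev t).1 = pi.

Definition truthful (N : finType) : nat -> N -> bool := fun _ _ => false.

Definition deviation (N : finType) (i : N) (t : nat) : nat -> N -> bool :=
  fun s j => (s == t) && (j == i).

(* With fewer than two agents no deal exists and the initial allocation is the
   only one, so leaving these instances out does not affect either property. *)
Definition pareto_optimal_dynamic (sigma : heuristic) : Prop :=
  forall (N R : finType) (n_gt1 : 1 < #|N|) (I : market N R),
    single_peaked I ->
    forall pi, is_outcome I (sigma N n_gt1) (@truthful N) pi ->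
    pareto_optimal I pi.

Definition strategy_proof (sigma : heuristic) : Prop :=
  forall (N R : finType) (n_gt1 : 1 < #|N|) (I : market N R),
    single_peaked I ->
    forall (i : N) (t : nat) pi pi',
      is_outcome I (sigma N n_gt1) (@truthful N) pi ->
      is_outcome I (sigma N n_gt1) (deviation i t) pi' ->
      ~ pref I i (pi' i) (pi i).

(* Outcomes exist and are unique, so quantifying over all [pi] with
   [is_outcome] above speaks of exactly one allocation. *)
Lemma outcome_unique (N R : finType) (I : market N R) sel dev pi pi' :
  is_outcome I sel dev pi -> is_outcome I sel dev pi' -> pi = pi'.
Proof.
by move=> [T HT] [T' HT']; rewrite -(HT (maxn T T')) ?leq_maxl// HT' ?leq_maxr.
Qed.

Lemma outcome_exists_from (N R : finType) (I : market N R) sel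
    (dev : nat -> N -> bool) (T : nat) :
  (forall t i, T <= t -> dev t i = false) ->
  exists pi, is_outcome I sel dev pi.
Proof.
move=> devT.
pose rk (i : N) (r : R) := #|[set r' | pref I i r' r]|.
pose Phi (pi : {ffun N -> R}) := \sum_(i : N) rk i (pi i).
have rk_lt i r r' : pref I i r r' -> rk i r < rk i r'.
  have [irr tr _] := prefP I i => rr'.
  apply: proper_card; apply/properP; split.
    by apply/subsetP => z; rewrite !inE => zr; exact: tr rr'.
  by exists r; rewrite !inE ?rr' ?irr.
have step t : T <= t -> (run I sel dev t.+1).1 = (run I sel dev t).1 \/
    Phi (run I sel dev t.+1).1 < Phi (run I sel dev t).1.
  move=> Tt /=; rewrite /round; case: (run I sel dev t) => pi h.
  case: (stopped h) => /=; first by left.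
  case: ifP => [|_]; last by left.
  rewrite /accepts !devT //= /improving; set d := sel h => /andP[A B]; right.
  rewrite /Phi (bigD1 (val d).1) //= [ltnRHS](bigD1 (val d).1) //=.
  rewrite -addSn; apply: leq_add; first exact: rk_lt.
  apply: leq_sum => i i1.
  have [->|i2] := eqVneq i (val d).2; first exact/ltnW/rk_lt.
  by rewrite ffunE (negPf i1) (negPf i2).
have [m] := ubnP (Phi (run I sel dev T).1).
elim: m T devT step => // m IH T devT step Pm.
have [[t [Tt Pt]]|nex] := Classical_Prop.classic
    (exists t, T <= t /\ Phi (run I sel dev t).1 < Phi (run I sel dev T).1).
  apply: (IH t) => [s i ts|s ts|]; [|exact/step/(leq_trans Tt)|].
    exact/devT/(leq_trans Tt).
  exact: leq_trans Pt _.
exists (run I sel dev T).1, T => t /subnK <-.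
elim: (t - T) => // k IHk; rewrite addSn.
have [->//|lt] := step _ (leq_addl k T).
by case: nex; exists (k + T).+1; rewrite leqW ?leq_addl// -[in ltnRHS]IHk.
Qed.

Lemma truthful_outcome_exists (N R : finType) (I : market N R) sel :
  exists pi, is_outcome I sel (@truthful N) pi.
Proof. exact: (@outcome_exists_from _ _ _ _ _ 0). Qed.

Lemma deviation_outcome_exists (N R : finType) (I : market N R) sel i t :
  exists pi, is_outcome I sel (deviation i t) pi.
Proof.
apply: (@outcome_exists_from _ _ _ _ _ t.+1) => s j ts.
by rewrite /deviation gtn_eqF.
Qed.

(* Swaps preserve bijectivity, so every state of a run is an allocation. *)
Lemma run_bij (N R : finType) (I : market N R) sel dev t :
  bijective (run I sel dev t).1.
Proof.
elim: t => [|t] /=; first exact: initP.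
rewrite /round; case: (run I sel dev t) => pi h /= bij.
case: (stopped h) => //=; case: ifP => // _.
apply: (eq_bij (bij_comp bij (inv_bij (@tpermK _ (val (sel h)).1
  (val (sel h)).2)))) => i /=.
by rewrite ffunE; case: tpermP => [->|->|/eqP/negPf-> /eqP/negPf->];
  rewrite ?eqxx //; case: eqP => // ->.
Qed.

Lemma heuristic_inhabited : exists sigma : heuristic, True.
Proof.
suff d (N : finType) (h : 1 < #|N|) : deal N by exists (fun N h _ => d N h).
pose x := enum_val (Ordinal (ltnW h)); pose y := enum_val (Ordinal h).
by exists (x, y); rewrite /= (inj_eq enum_val_inj).
Qed.

(* Main.v *)
Require Import Defs.
From mathcomp Require Import all_boot.

Set Implicit Arguments.
Unset Strict Implicit.
Unset Printing Implicit Defensive.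

(** Three agents x, y, z suffice, where <x, y> is the deal proposed first and
    each agent initially owns the resource of the same name.  Along the axis
    x - z - y, let x and y rank z > x > y, and let z rank y > z > x.
    Truthfully the only deal that can ever succeed is <y, z>, which leaves x
    with her own resource.  If instead x accepts the losing deal <x, y> at the
    first round, then <x, z> is the only deal that can succeed next, and it
    gives x her top resource z.  That deal must eventually be proposed, because
    this run coincides with the truthful run of the market in which x ranks
    z > y > x, whose Pareto-optimal outcome requires <x, z>. *)

Definition ranked {T : eqType} (s : seq T) : rel T :=
  fun r r' => index r s < index r' s.

Lemma ranked_strict_linear_order (T : eqType) (s : seq T) :
  (forall r, r \in s) -> strict_linear_order (ranked s).
Proof.
move=> sT; split=> [r|r2 r1 r3|r r' neq_rr']; rewrite /ranked ?ltnn //.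
  exact: ltn_trans.
rewrite -neq_ltn; apply: contra neq_rr' => /eqP eq_idx; apply/eqP.
by rewrite -(nth_index r (sT r)) eq_idx nth_index.
Qed.

Lemma identity_bijective (T : finType) : bijective [ffun i : T => i].
Proof. by exists id => i; rewrite ffunE. Qed.

Definition list_market {T : finType} {L : T -> seq T}
    (LT : forall i r, r \in L i) : market T T :=
  Market (fun i => ranked_strict_linear_order (LT i)) (identity_bijective T).

Lemma is_top_list_market (T : finType) (L : T -> seq T)
    (LT : forall i r, r \in L i) i t :
  is_top (list_market LT) i t -> t = head t (L i).
Proof.
move=> top; apply/eqP; apply: contraT; rewrite eq_sym => /top.
by rewrite /= /ranked; have := LT i t; case: (L i) => //= h s _; rewrite eqxx.
Qed.

Lemma third_element (T : finType) (x y : T) :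
  #|T| = 3 -> x != y -> exists z, [/\ x != z, y != z & T =i [:: x; y; z]].
Proof.
move=> T3 neq_xy.
have /subsetPn[z _ /=] : ~~ (T \subset [:: x; y]).
  apply/negP => /subset_leq_card; rewrite T3.
  by move=> /leq_trans /(_ (card_size _)).
rewrite !inE negb_or => /andP[neq_zx neq_zy].
exists z; split; rewrite 1?eq_sym //.
have uniq_xyz : uniq [:: x; y; z].
  by rewrite /= !inE negb_or neq_xy (eq_sym x) neq_zx (eq_sym y) neq_zy.
apply/fsym/subset_cardP; last exact/subsetP.
by rewrite (card_uniqP uniq_xyz) T3.
Qed.

Section ThreeAgents.

Context {T : finType} {x y z : T}.
Hypotheses (neq_xy : x != y) (neq_xz : x != z) (neq_yz : y != z).
Hypothesis xyzT : T =i [:: x; y; z].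

Let neqE := (negPf neq_xy, negPf neq_xz, negPf neq_yz,
  eq_sym y x, eq_sym z x, eq_sym z y, eqxx).

Lemma three_ind (P : T -> Prop) : P x -> P y -> P z -> forall r, P r.
Proof.
move=> Px Py Pz r.
have: r \in [:: x; y; z] by rewrite -xyzT.
by rewrite !inE => /or3P[] /eqP->.
Qed.

(** Only the list of [x] is a parameter: it is all that distinguishes the two markets. *)
Definition profile (sx : seq T) (i : T) : seq T :=
  if i == x then sx else if i == y then [:: z; x; y] else [:: y; z; x].

Lemma mem_profile_true i r : r \in profile [:: z; x; y] i.
Proof.
by elim/three_ind: i; elim/three_ind: r; rewrite /profile !neqE !inE !neqE.
Qed.

Lemma mem_profile_alt i r : r \in profile [:: z; y; x] i.
Proof.
by elim/three_ind: i; elim/three_ind: r; rewrite /profile !neqE !inE !neqE.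
Qed.

Definition market_true : market T T := list_market mem_profile_true.
Definition market_alt : market T T := list_market mem_profile_alt.

Lemma axis_linear : strict_linear_order (ranked [:: x; z; y]).
Proof.
by apply: ranked_strict_linear_order; apply: three_ind; rewrite !inE !neqE.
Qed.

Lemma single_peaked_true : single_peaked market_true.
Proof.
exists (ranked [:: x; z; y]); split; first exact: axis_linear.
apply: three_ind => t r r' /is_top_list_market;
  rewrite /profile !neqE /= => ->; rewrite /ranked /=;
  elim/three_ind: r; elim/three_ind: r'; rewrite /profile !neqE //= !neqE //.
Qed.

(** The peak z of agent x lies between x and y on the axis, so she may rank these two in either
    order. *)
Lemma single_peaked_alt : single_peaked market_alt.
Proof.
exists (ranked [:: x; z; y]); split; first exact: axis_linear.
apply: three_ind => t r r' /is_top_list_market;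
  rewrite /profile !neqE /= => ->; rewrite /ranked /=;
  elim/three_ind: r; elim/three_ind: r'; rewrite /profile !neqE //= !neqE //.
Qed.

Definition holds (pi : {ffun T -> T}) (a b c : T) : Prop :=
  [/\ pi x = a, pi y = b & pi z = c].

(** Initially x refuses y and z refuses x, her worst resource. Once <y, z> has succeeded, y and z
    hold their tops and refuse everything. *)
Lemma holds_true_run sel t :
  let pi := (run market_true sel (@truthful T) t).1 in
  holds pi x y z \/ holds pi x z y.
Proof.
elim: t => [|t] /=; first by left; split; rewrite ffunE.
rewrite /round; case: (run _ _ _ t) => pi h /= IH.
case: ifP => //= _; case: ifP => //=.
case: (sel h) => -[u v] /=; rewrite /accepts /improving /swap /= !ffunE.
rewrite /ranked /truthful /= /profile.
case: IH => -[pix piy piz]; elim/three_ind: u; elim/three_ind: v;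
  rewrite !neqE ?pix ?piy ?piz /= !neqE //= => _ _.
all: by right; split; rewrite !ffunE /= !neqE.
Qed.

(** The two rankings of x differ only on the pair x, y. This could matter only for <x, y> while x
    holds y, and there agent y refuses in both markets. *)
Lemma round_after_first_swap sel dev t s :
  (forall i, dev t i = false) ->
  holds s.1 y x z \/ holds s.1 z x y ->
  let s' := round market_true sel dev t s in
  s' = round market_alt sel (@truthful T) t s /\
  (holds s'.1 y x z \/ holds s'.1 z x y).
Proof.
case: s => pi h devF Hs; rewrite /round; case: ifP => //= _.
rewrite /accepts !devF /improving /swap /= /ranked /truthful /= /profile.
case: (val (sel h)) => u v; rewrite !ffunE /=.
case: Hs => -[pix piy piz]; elim/three_ind: u; elim/three_ind: v;
  rewrite !neqE ?pix ?piy ?piz /= !neqE //=; split=> //.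
all: try by left.
all: by right; split; rewrite ?ffunE /= ?neqE.
Qed.

(** At round 0 accepting <x, y> is a deviation for x in one market and truthful in the other; y
    accepts in both. The histories thus agree, and so do all later proposals. *)
Lemma deviation_run_alt sel t :
  val (sel [::]) = (x, y) ->
  let s := run market_true sel (deviation x 0) t.+1 in
  s = run market_alt sel (@truthful T) t.+1 /\
  (holds s.1 y x z \/ holds s.1 z x y).
Proof.
move=> sel0; elim: t => [|t [eq_run Hs]]; last first.
  have [round_alt Hs'] := @round_after_first_swap sel (deviation x 0) t.+1 _
    (fun=> erefl) Hs.
  by split=> //; rewrite [LHS]round_alt eq_run.
rewrite /= /round.
have -> : @stopped T [::] = false.
  by apply/negbTE/forallPn; exists x; apply/forallPn; exists y; rewrite neq_xy.
rewrite /accepts /improving /deviation /truthful sel0 /= /ranked !ffunE sel0 /=.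
rewrite /profile !neqE /= !neqE /=; split=> //.
by left; split; rewrite !ffunE sel0 /= !neqE ?ffunE.
Qed.

Lemma not_pareto_optimal_alt pi :
  holds pi y x z -> ~ pareto_optimal market_alt pi.
Proof.
move=> [pix piy piz] [].
(* The result of <x, z>: agents x and z get their tops and y keeps x. *)
pose f i := if i == x then z else if i == y then x else y.
exists [ffun i => f i]; split.
- exists (fun r => if r == z then x else if r == x then y else z);
    by apply: three_ind; rewrite ?ffunE /f !neqE.
- by apply: three_ind; rewrite ffunE /f /= /ranked /profile ?pix ?piy ?piz !neqE
    /= !neqE; auto.
- by exists x; rewrite ffunE /f /= /ranked /profile pix !neqE /= !neqE.
Qed.

End ThreeAgents.

Theorem proposition3 (sigma : heuristic) :
  ~ (pareto_optimal_dynamic sigma /\ strategy_proof sigma).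
Proof.
move=> [PO SP].
have I3_gt1 : 1 < #|'I_3| by rewrite card_ord.
pose sel := sigma _ I3_gt1.
(* The first proposal depends on the agents alone, so the preferences can be built around it. *)
case sel0: (sel [::]) => [[x y] /= neq_xy]; move/(congr1 val): sel0 => /= sel0.
have [z [neq_xz neq_yz xyzT]] := third_element (card_ord 3) neq_xy.
pose I := market_true neq_xy neq_xz neq_yz xyzT.
pose I' := market_alt neq_xy neq_xz neq_yz xyzT.
have [pi out_pi] := truthful_outcome_exists I sel.
have [pi' out_pi'] := deviation_outcome_exists I sel x 0.
have dev_run t := deviation_run_alt neq_xy neq_xz neq_yz xyzT t sel0.
have pi'_alt : is_outcome I' sel (@truthful _) pi'.
  (* The bound is shifted by one because the runs are compared only after the first round. *)
  case: out_pi' => n run_n; exists n.+1 => -[|t] // lt_nt.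
  by have [<- _] := dev_run t; apply: run_n; exact: ltnW.
have pix : pi x = x.
  case: out_pi => n /(_ n (leqnn n)) <-.
  by case: (holds_true_run neq_xy neq_xz neq_yz xyzT sel n) => -[].
have pi'x : pi' x = z.
  have [n /(_ n.+1 (leqnSn n)) run_n] := out_pi'.
  (* Of the two possible final states, Pareto-optimality in [I'] excludes the one where x still
     holds y. *)
  have [_] := dev_run n; rewrite run_n => -[] Hpi'; last by case: Hpi'.
  have := PO _ _ I3_gt1 _ (single_peaked_alt neq_xy neq_xz neq_yz xyzT)
    _ pi'_alt.
  by case/not_pareto_optimal_alt.
apply: (SP _ _ I3_gt1 _ (single_peaked_true neq_xy neq_xz neq_yz xyzT)
  _ _ _ _ out_pi out_pi').
by rewrite pix pi'x /= /ranked /profile eqxx /= eqxx eq_sym (negPf neq_xz).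
Qed.
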